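(* Let $n\geq 1$ and let $A_1, A_2, A_3, A_4\in \mathbb{C}^{n\times n}$ be positive definite matrices. Then $$Tr\left[A_1(A_2+A_3)^{-1}+A_2(A_3+A_4)^{-1}+A_3(A_4+A_1)^{-1}+A_4(A_1+A_2)^{-1}\right]\geq 2n.$$
   Context: A matrix $A\in\mathbb{C}^{n\times n}$ is called positive definite if it is Hermitian and $x^*Ax>0$ for all $0\neq x\in\mathbb{C}^n$. $Tr$ denotes the trace; the trace in the claim is real. *)

(* Defs.v *)
From HB Require Import structures.
From mathcomp Require Import all_boot all_order all_algebra.
From mathcomp Require Import complex reals.

Set Implicit Arguments.
Unset Strict Implicit.
Unset Printing Implicit Defensive.

Import Order.TTheory GRing.Theory Num.Theory.

Local Open Scope ring_scope.
Local Open Scope sesquilinear_scope.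

(* In a numClosedFieldType, such as R[i], z <= w (resp. z < w) means that
   w - z is real and nonnegative (resp. positive), so the strict inequality
   below also asserts that the quadratic form is real. *)
Definition posdefmx (C : numClosedFieldType) (n : nat) (A : 'M[C]_n) : Prop :=
  A \is hermsymmx /\
  forall x : 'cV[C]_n, x != 0 -> 0 < (x ^t* *m A *m x) 0 0.

(* Main.v *)
Require Import Defs.
From mathcomp Require Import all_boot all_order all_algebra.
From mathcomp Require Import complex reals.
From mathcomp Require Import ring.

Set Implicit Arguments.
Unset Strict Implicit.
Unset Printing Implicit Defensive.

Import Order.TTheory GRing.Theory Num.Theory.

Local Open Scope ring_scope.
Local Open Scope complex_scope.

(** Write [S = A1 + A2 + A3 + A4].  For [A] positive semidefinite, [X] positive
    definite and [Y] Hermitian, [X^-1 - 2 Y + Y X Y = (X^-1 - Y) X (X^-1 - Y)]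
    is positive semidefinite, hence [tr (A X^-1) >= 2 tr (A Y) - tr (A Y X Y)].
    Using this in each of the four terms with the same matrix [Y = 2 S^-1]
    bounds the cyclic sum below by [4n - 4 (q12 + q13 + q23 + ...)], where
    [qij = tr (Ai S^-1 Aj S^-1)] is a symmetric bilinear form in [Ai], [Aj].
    As [n = tr (S S^-1 S S^-1)], this lower bound exceeds [2n] by twice
    [q (A1 - A3) (A1 - A3) + q (A2 - A4) (A2 - A4) >= 0]. *)

Local Open Scope sesquilinear_scope.

Section PositiveSemidefinite.
Context {C : numClosedFieldType}.
Implicit Types (n : nat).

Definition psdmx n (A : 'M[C]_n) : Prop :=
  A \is hermsymmx /\ forall x : 'cV[C]_n, 0 <= (x ^t* *m A *m x) 0 0.

Lemma adjmxM m n p (A : 'M[C]_(m, n)) (B : 'M[C]_(n, p)) :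
  (A *m B)^t* = B^t* *m A^t*.
Proof. by rewrite trmx_mul map_mxM. Qed.

Lemma adjmxB m n (A B : 'M[C]_(m, n)) : (A - B)^t* = A^t* - B^t*.
Proof. by rewrite linearB map_mxB. Qed.

Lemma adjmxD m n (A B : 'M[C]_(m, n)) : (A + B)^t* = A^t* + B^t*.
Proof. by rewrite linearD map_mxD. Qed.

Lemma hermsymmxP n (A : 'M[C]_n) : reflect (A^t* = A) (A \is hermsymmx).
Proof.
by apply: (iffP (is_hermitianmxP _ _ _)); rewrite expr0 scale1r => /esym.
Qed.

Lemma posdefmx_adj n (A : 'M[C]_n) : posdefmx A -> A^t* = A.
Proof. by case=> /hermsymmxP. Qed.

Lemma posdefmx_psd n (A : 'M[C]_n) : posdefmx A -> psdmx A.
Proof.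
move=> [hA pA]; split=> // x; have [->|/pA/ltW//] := eqVneq x 0.
by rewrite mulmx0 mxE.
Qed.

Lemma posdefmxD n (A B : 'M[C]_n) :
  posdefmx A -> posdefmx B -> posdefmx (A + B).
Proof.
move=> [/hermsymmxP hA pA] [/hermsymmxP hB pB]; split.
  by apply/hermsymmxP; rewrite adjmxD hA hB.
by move=> x x0; rewrite mulmxDr mulmxDl mxE addr_gt0 ?pA ?pB.
Qed.

(** A row vector [v] with [v *m A = 0] makes the quadratic form vanish at the column [v^t*], so
    positivity forces [v = 0]. *)
Lemma posdefmx_unit n (A : 'M[C]_n) : posdefmx A -> A \in unitmx.
Proof.
move=> [/hermsymmxP hA pA]; rewrite -row_free_unit -kermx_eq0.
apply/rowV0P => v /sub_kermxP vA; apply/eqP; apply: contraT => v0.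
have w0 : v^t* != 0.
  by apply: contraNneq v0 => w; rewrite -[v]trmxCK w trmx0 map_mx0.
by have := pA _ w0; rewrite trmxCK vA mul0mx mxE ltxx.
Qed.

Lemma invmx_herm n (A : 'M[C]_n) :
  A \is hermsymmx -> A \in unitmx -> (invmx A)^t* = invmx A.
Proof.
move=> /hermsymmxP hA uA.
have eA : (invmx A)^t* *m A = 1%:M.
  by rewrite -{2}hA -adjmxM mulmxV // trmx1 map_mx1.
by rewrite -[LHS](mulmxK uA) eA mul1mx.
Qed.

Lemma psdmx_congr n (A B : 'M[C]_n) : psdmx A -> psdmx (B *m A *m B^t*).
Proof.
move=> [/hermsymmxP hA pA]; split.
  by apply/hermsymmxP; rewrite !adjmxM trmxCK hA mulmxA.
by move=> x; have := pA (B^t* *m x); rewrite adjmxM trmxCK !mulmxA.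
Qed.

(** The inverse is congruent to [A] itself, since [A^-1 = A^-1 A (A^-1)^*]. *)
Lemma psdmx_inv n (A : 'M[C]_n) : posdefmx A -> psdmx (invmx A).
Proof.
move=> pA; have uA := posdefmx_unit pA.
have := psdmx_congr (invmx A) (posdefmx_psd pA).
by rewrite (invmx_herm pA.1 uA) mulVmx // mul1mx.
Qed.

Lemma psdmx_diag_ge0 n (A : 'M[C]_n) i : psdmx A -> 0 <= A i i.
Proof.
move=> [_ /(_ (delta_mx i 0))].
by rewrite trmx_delta map_delta_mx -rowE -colE !mxE.
Qed.

Lemma tr_psdmxM_ge0 n (A B : 'M[C]_n) :
  psdmx A -> psdmx B -> 0 <= \tr (A *m B).
Proof.
move=> pA pB; have /hermitian_normalmx/orthomx_spectralP := pA.1.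
set U := spectralmx A; set d := spectral_diag A => eA.
have uU : U \in unitmx := spectral_unit A.
have UV : invmx U = U^t* := invmx_unitary (spectral_unitarymx A).
have eD : diag_mx d = U *m A *m U^t*.
  by rewrite {1}eA -UV !mulmxA mulmxV // mul1mx mulmxK.
rewrite eA -!mulmxA mxtrace_mulC -!mulmxA UV mul_diag_mx !mulmxA.
apply: sumr_ge0 => i _; rewrite mxE mulr_ge0 //.
  have -> : d 0 i = diag_mx d i i by rewrite mxE eqxx.
  by rewrite eD; apply/psdmx_diag_ge0/psdmx_congr.
exact/psdmx_diag_ge0/psdmx_congr.
Qed.

Lemma mxtraceB n (A B : 'M[C]_n) : \tr (A - B) = \tr A - \tr B.
Proof. exact: linearB. Qed.

Lemma tr_mulmx_invmx_ge n (A X Y : 'M[C]_n) :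
  psdmx A -> posdefmx X -> Y^t* = Y ->
  0 <= \tr (A *m invmx X) - \tr (A *m Y) *+ 2 + \tr (A *m Y *m X *m Y).
Proof.
move=> pA pX hY; have uX := posdefmx_unit pX.
have hV := invmx_herm pX.1 uX.
have := tr_psdmxM_ge0 pA (psdmx_congr (invmx X - Y) (posdefmx_psd pX)).
rewrite adjmxB hV hY !(mulmxBl, mulmxBr) mulVmx // mul1mx -(mulmxA Y X).
rewrite (mulmxV uX) mulmx1 !mulmxA mulmx1 !mxtraceB.
by congr (_ <= _); ring.
Qed.

Lemma tr_shapiro4 n (A1 A2 A3 A4 : 'M[C]_n) :
  posdefmx A1 -> posdefmx A2 -> posdefmx A3 -> posdefmx A4 ->
  (2 * n)%:R <= \tr (A1 *m invmx (A2 + A3) + A2 *m invmx (A3 + A4)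
                     + A3 *m invmx (A4 + A1) + A4 *m invmx (A1 + A2)).
Proof.
move=> p1 p2 p3 p4.
have pS := posdefmxD (posdefmxD (posdefmxD p1 p2) p3) p4.
set S := A1 + A2 + A3 + A4 in pS.
have uS := posdefmx_unit pS; set W := invmx S.
have hW : W^t* = W := invmx_herm pS.1 uS.
pose q A B := \tr (A *m W *m B *m W).
have qC A B : q A B = q B A.
  by rewrite /q -!mulmxA mulmxA mxtrace_mulC !mulmxA.
have qDl A B D : q (A + B) D = q A D + q B D by rewrite /q !mulmxDl mxtraceD.
have qDr A B D : q D (A + B) = q D A + q D B by rewrite !(qC D) qDl.
have qBl A B D : q (A - B) D = q A D - q B D by rewrite /q !mulmxBl mxtraceB.
have qBr A B D : q D (A - B) = q D A - q D B by rewrite !(qC D) qBl.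
(* For Hermitian [D], [q D D] is the trace of the product of [D W D^*] and [W], both positive
   semidefinite. *)
have q_ge0 D : D^t* = D -> 0 <= q D D.
  move=> hD; have := tr_psdmxM_ge0 (psdmx_congr D (psdmx_inv pS)) (psdmx_inv pS).
  by rewrite hD.
have hB (A B : 'M[C]_n) : posdefmx A -> posdefmx B -> (A - B)^t* = A - B.
  by move=> pA pB; rewrite adjmxB !posdefmx_adj.
(* With [Y = W + W], [2 tr (A Y)] gives [4 tr (A W)], and [tr (A Y X Y)] gives [4 q A X]. *)
have gap A X : posdefmx A -> posdefmx X ->
    0 <= \tr (A *m invmx X) - \tr (A *m W) *+ 4 + q A X *+ 4.
  move=> pA pX; have hY : (W + W)^t* = W + W by rewrite adjmxD hW.
  have := tr_mulmx_invmx_ge (posdefmx_psd pA) pX hY.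
  rewrite !(mulmxDr, mulmxDl) !mxtraceD -/(q A X).
  by congr (_ <= _); ring.
have trS : \tr (A1 *m W) + \tr (A2 *m W) + \tr (A3 *m W) + \tr (A4 *m W) = n%:R.
  by rewrite -!mxtraceD -!mulmxDl mulmxV // mxtrace1.
have qS : q S S = n%:R by rewrite /q mulmxV // mul1mx mulmxV // mxtrace1.
rewrite -subr_ge0.
have := addr_ge0 (addr_ge0 (gap _ _ p1 (posdefmxD p2 p3))
                           (gap _ _ p2 (posdefmxD p3 p4)))
                 (addr_ge0 (gap _ _ p3 (posdefmxD p4 p1))
                           (gap _ _ p4 (posdefmxD p1 p2))).
have := addr_ge0 (q_ge0 _ (hB _ _ p1 p3)) (q_ge0 _ (hB _ _ p2 p4)).
move=> /(mulrn_wge0 2) /addr_ge0 H /H; congr (_ <= _).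
rewrite natrM !mxtraceD.
(* The part [4n] is rewritten by [trS] to cancel the linear terms [tr (Ai W)] of the four gaps; the
   part [2n] becomes [2 q S S], to be matched with the quadratic terms. *)
have -> : (2%:R * n%:R : C) = n%:R *+ 4 - n%:R *+ 2 by ring.
rewrite -{1}trS -qS /S !(qBl, qBr) !(qDl, qDr).
(* Symmetry puts the indices of every [q] term in increasing order, leaving a linear identity for
   [ring]. *)
rewrite (qC A2 A1) (qC A3 A1) (qC A4 A1) (qC A3 A2) (qC A4 A2) (qC A4 A3).
ring.
Qed.

End PositiveSemidefinite.

Local Close Scope sesquilinear_scope.

(* R : realType is the field of real numbers and R[i] its complexification;
   the order on R[i] makes the inequality also assert that the trace is real. *)
Theorem theorem2p7 (R : realType) (n : nat) (hn : (1 <= n)%N)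
    (A1 A2 A3 A4 : 'M[R[i]]_n)
    (hA1 : posdefmx A1) (hA2 : posdefmx A2)
    (hA3 : posdefmx A3) (hA4 : posdefmx A4) :
  (2 * n)%:R <= \tr (A1 *m invmx (A2 + A3) + A2 *m invmx (A3 + A4)
                     + A3 *m invmx (A4 + A1) + A4 *m invmx (A1 + A2)).
Proof. exact: tr_shapiro4. Qed.
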